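(* Let $W=\{w(s)\mid s\in\Sigma\}$ be a tight continuous frame (with constant $1$) in the Hilbert space $\mathcal H$, contained and total in a Fréchet space $\mathcal G$ continuously and densely embedded in $\mathcal H$, such that $s\mapsto\langle u,w(s)\rangle$ is continuous for every $u\in\mathcal G'$. Let $\mathcal M$ be a solid Banach space of functions on $\Sigma$ with absolutely continuous norm, and assume that the completed coorbit space $\widetilde{\mathsf{co}}(\mathcal M)$ is continuously embedded in $\mathcal G'_\sigma$. Then a bounded subset $\Omega$ of $\widetilde{\mathsf{co}}(\mathcal M)$ is relatively compact if and only if $\phi_W(\Omega)$ is $\mathcal K(\Sigma)$-tight in $\mathcal M$, i.e. if and only if for every $\epsilon>0$ there is a compact set $L\subset\Sigma$ such that $\sup_{u\in\Omega}\|\chi_L\phi_W(u)-\phi_W(u)\|_{\mathcal M}\le\epsilon$.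
   Context: $\mathcal H$ is a complex separable Hilbert space; $\Sigma$ is a Hausdorff, locally compact, $\sigma$-compact space with a fixed Radon measure $\mu$. Tight continuous frame (constant $1$): $W=\{w(s)\mid s\in\Sigma\}\subset\mathcal H$, the map $s\mapsto w(s)$ is weakly continuous, and $\langle u,v\rangle=\int_\Sigma\langle u,w(s)\rangle\langle w(s),v\rangle\,d\mu(s)$ for all $u,v\in\mathcal H$. $\mathcal G'$ is the topological dual of $\mathcal G$, where by the Riesz isomorphism one has a Gelfand triple $\mathcal G\subset\mathcal H\subset\mathcal G'$; $\langle u,v\rangle$, for $u\in\mathcal G'$, $v\in\mathcal G$, denotes the value of $u$ on $v$ and extends the inner product of $\mathcal H$ (so $\mathcal G'$ is realized as the continuous antilinear functionals on $\mathcal G$). $\mathcal G'_\sigma$ is $\mathcal G'$ with the weak-$*$ topology. ''Total'' means having dense linear span. For $u\in\mathcal G'$, $\phi_W(u)$ is the continuous function $[\phi_W(u)](s):=\langle u,w(s)\rangle$ on $\Sigma$. The coorbit space is $\mathsf{co}(\mathcal M):=\{u\in\mathcal G'\mid\phi_W(u)\in\mathcal M\}$ with norm $\|u\|_{\mathsf{co}(\mathcal M)}:=\|\phi_W(u)\|_{\mathcal M}$; $\widetilde{\mathsf{co}}(\mathcal M)$ is its completion, and the canonical isometric extension $\widetilde{\mathsf{co}}(\mathcal M)\to\mathcal M$ of $\phi_W$ is denoted by the same symbol. The assumption that $\widetilde{\mathsf{co}}(\mathcal M)$ is continuously embedded in $\mathcal G'_\sigma$ means that the inclusion $\mathsf{co}(\mathcal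 M)\to\mathcal G'_\sigma$ extends to a continuous injective linear map on $\widetilde{\mathsf{co}}(\mathcal M)$. Solid Banach space of functions with absolutely continuous norm: a Banach space $\mathcal M$ of ($\mu$-a.e. classes of) $\mu$-measurable functions $\Sigma\to\mathbb C$ such that: (i) $\mathcal M$ contains the characteristic functions of all measurable $M\subset\Sigma$ with $\mu(M)<\infty$; (ii) if $f,g:\Sigma\to\mathbb C$ are $\mu$-measurable, $|f|\le|g|$ a.e. and $g\in\mathcal M$, then $f\in\mathcal M$ and $\|f\|_{\mathcal M}\le\|g\|_{\mathcal M}$; (iii) (dominated convergence) for $f,g\in\mathcal M$, if $f_n:\Sigma\to\mathbb C$ are measurable, $|f_n|\le|g|$ and $f_n\to f$ $\mu$-a.e., then $\|f_n-f\|_{\mathcal M}\to0$. $\mathcal K(\Sigma)$ is the family of characteristic functions $\chi_L$ of compact subsets $L\subset\Sigma$, acting on $\mathcal M$ by pointwise multiplication. *)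

(* Defs.v *)
From HB Require Import structures.
From mathcomp Require Import all_boot all_order all_algebra.
From mathcomp Require Import all_classical all_reals all_analysis.
From mathcomp Require Import measurable_realfun sesquilinear complex.

Set Implicit Arguments.
Unset Strict Implicit.
Unset Printing Implicit Defensive.

Import Order.TTheory GRing.Theory Num.Theory.
Import numFieldNormedType.Exports.

Local Open Scope classical_set_scope.
Local Open Scope ring_scope.
Local Open Scope complex_scope.

(** Measurable sets of [borel T] are the Borel sets of [T]; the underlying type
    is [T] itself. *)
Notation borel T := (g_sigma_algebraType (@open T)).

Section Spaces.

Definition sigma_compact (T : topologicalType) : Prop :=
  exists L : nat -> set T,
    (forall n, compact (L n)) /\ \bigcup_n L n = [set: T].

Definition separable (T : topologicalType) : Prop :=
  exists2 D : set T, countable D & dense D.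

Definition metrizable (R : realType) (X : topologicalType) : Prop :=
  exists d : X -> X -> R,
    [/\ forall x y, d x y = 0 <-> x = y,
        forall x y, d x y = d y x,
        forall x y z, d x z <= d x y + d y z &
        forall x, nbhs x =
          filter_from [set e : R | 0 < e] (fun e => [set y | d x y < e])].

(** [tvsType] is the library's locally convex topological vector space. *)
Record frechet_space (R : realType) (G : tvsType R[i]) : Prop := {
  frechet_metrizable : metrizable R G ;
  frechet_complete : forall F : set_system G,
    ProperFilter F -> cauchy F -> exists x : G, F --> x }.

Definition linspan (K : fieldType) (V : lmodType K) (A : set V) : set V :=
  [set x | exists n (c : 'I_n -> K) (a : 'I_n -> V),
     (forall i, A (a i)) /\ x = \sum_(i < n) c i *: a i].

Definition total_set (K : numFieldType) (V : tvsType K) (A : set V) : Prop :=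
  dense (linspan A).

End Spaces.

(** The topological (anti)dual [G'] : continuous antilinear functionals. *)
Section AntiDual.
Variables (R : realType) (G : tvsType R[i]).

Definition is_antidual : {pred G -> R[i]^o} :=
  mem [set f : G -> R[i]^o |
    (forall (a : R[i]) (u v : G), f (a *: u + v) = (a^*)%C * f u + f v)
    /\ continuous f].

Lemma antidual_submod_closed : submod_closed is_antidual.
Proof.
split.
  apply/mem_set; split=> [a u v|]; first by rewrite mulr0 addr0.
  exact: cst_continuous.
move=> b f g /set_mem[fL fC] /set_mem[gL gC]; apply/mem_set; split.
  move=> a u v.
  change (b * f (a *: u + v) + g (a *: u + v) =
          (a^*)%C * (b * f u + g u) + (b * f v + g v)).
  rewrite fL gL !mulrDr addrACA; congr (_ + _ + _).
  by rewrite mulrCA.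
move=> x; apply: (@continuousD R[i] R[i]^o G (b \*: f) g); last exact: gC.
by apply: (@continuousZl_tmp R[i] R[i]^o G f b x); exact: fC.
Qed.

HB.instance Definition _ := GRing.isSubmodClosed.Build R[i] (G -> R[i]^o)
  is_antidual antidual_submod_closed.

Record antidual := Antidual {
  antidual_fun :> G -> R[i]^o ;
  antidual_funP : antidual_fun \in is_antidual }.

HB.instance Definition _ := [isSub of antidual for antidual_fun].
HB.instance Definition _ := [Choice of antidual by <:].
HB.instance Definition _ := [SubChoice_isSubLmodule of antidual by <:].

(** [antidual] carries the weak-* topology: the coarsest one making all
    evaluations [u |-> u v] continuous. *)
HB.instance Definition _ := Topological.copy antidual
  (initial_topology
     (fun u : antidual => (antidual_fun u : {ptws G -> R[i]^o}))).

End AntiDual.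

Section Measure.
Variables (R : realType) (T : ptopologicalType).
Variable mu : {measure set (borel T) -> \bar R}.

Record radon_measure : Prop := {
  radon_compact : forall L : set T, compact L -> (mu L < +oo)%E ;
  radon_outer : forall A : set (borel T), measurable A ->
    mu A = ereal_inf [set mu U | U in [set U : set T | open U /\ A `<=` U]] ;
  radon_inner : forall U : set T, open U ->
    mu U = ereal_sup [set mu L | L in [set L : set T | compact L /\ L `<=` U]]
}.

(** [completed_algebra_gen mu] is the completion of the Borel sigma-algebra
    with respect to [mu] : the sets [A `|` N], [A] Borel and [N] negligible. *)
Definition mu_measurable (f : T -> R[i]) : Prop :=
  forall U : set R[i]^o, open U -> completed_algebra_gen mu (f @^-1` U).

Definition cintegrable (f : T -> R[i]) : Prop :=
  mu.-integrable [set: borel T] (fun s => (complex.Re (f s))%:E) /\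
  mu.-integrable [set: borel T] (fun s => (complex.Im (f s))%:E).

Definition cintegral (f : T -> R[i]) : R[i] :=
  Rintegral mu [set: borel T] (fun s => complex.Re (f s)) +i*
  Rintegral mu [set: borel T] (fun s => complex.Im (f s)).

End Measure.

Section Frame.
Variables (R : realType) (T : ptopologicalType).
Variable mu : {measure set (borel T) -> \bar R}.
Variables (H : completeNormedModType R[i]) (dot : {dot H for @Num.conj R[i]}).

(** [dot] is linear in its first argument and antilinear in the second one. *)
Definition inner_product_norm : Prop := forall u : H, `|u| ^+ 2 = dot u u.

Record tight_frame (w : T -> H) : Prop := {
  frame_weakly_continuous :
    forall u : H, continuous (fun s => dot u (w s) : R[i]^o) ;
  frame_integrable :
    forall u v : H, cintegrable mu (fun s => dot u (w s) * dot (w s) v) ;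
  frame_reproducing :
    forall u v : H, dot u v = cintegral mu (fun s => dot u (w s) * dot (w s) v)
}.

End Frame.

(** Banach spaces of a.e. classes of functions. An element [f] of the Banach
    space [M] is a class, and [rep f] is a representative of it. *)
Section FunctionSpace.
Variables (R : realType) (T : ptopologicalType).
Variable mu : {measure set (borel T) -> \bar R}.
Variables (M : completeNormedModType R[i]) (rep : M -> borel T -> R[i]).

Record function_space : Prop := {
  rep_measurable : forall f : M, mu_measurable mu (rep f) ;
  rep_linear : forall (a : R[i]) (f g : M),
    rep (a *: f + g) = (fun s => a * rep f s + rep g s) %[ae mu] ;
  rep_injective : forall f g : M, rep f = rep g %[ae mu] -> f = g
}.

Definition in_space (F : borel T -> R[i]) : Prop :=
  exists f : M, rep f = F %[ae mu].

(** The class in [M] of a function that belongs to [M] (and 0 otherwise); the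
    norm of such a function is [`|cls F|]. *)
Definition cls (F : borel T -> R[i]) : M :=
  xget 0 [set f : M | rep f = F %[ae mu]].

Record solid_absolutely_continuous : Prop := {
  solid_indic : forall A : set (borel T), measurable A -> (mu A < +oo)%E ->
    in_space (fun s => \1_A s) ;
  solid_le : forall F G : borel T -> R[i],
    mu_measurable mu F -> mu_measurable mu G ->
    (\forall s \ae mu, `|F s| <= `|G s|) ->
    in_space G -> in_space F /\ `|cls F| <= `|cls G| ;
  solid_dominated : forall (F G : borel T -> R[i]) (Fn : nat -> borel T -> R[i]),
    in_space F -> in_space G ->
    (forall n, mu_measurable mu (Fn n)) ->
    (forall n, \forall s \ae mu, `|Fn n s| <= `|G s|) ->
    (\forall s \ae mu, (fun n => Fn n s : R[i]^o) @ \oo --> (F s : R[i]^o)) ->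
    (fun n => `|cls (fun s => Fn n s - F s)| : R[i]^o) @ \oo --> (0 : R[i]^o)
}.

Definition mul_indic (L : set T) (f : M) : M :=
  cls (fun s => \1_L s * rep f s).

(** Tightness with respect to the multiplications by [\1_L], [L] compact. *)
Definition compact_tight (S : set M) : Prop :=
  forall e : R, 0 < e -> exists2 L : set T, compact L &
    forall f : M, S f -> `|mul_indic L f - f| <= e%:C.

End FunctionSpace.

Section Coorbit.
Variables (R : realType) (T : ptopologicalType).
Variable mu : {measure set (borel T) -> \bar R}.
Variables (G : tvsType R[i]) (w : T -> G).
Variables (M : completeNormedModType R[i]) (rep : M -> borel T -> R[i]).

Definition phiW (u : antidual G) : T -> R[i]^o := fun s => u (w s).

Definition coorbit : set (antidual G) := [set u | in_space mu rep (phiW u)].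

Definition coorbit_norm (u : antidual G) : R[i] := `|cls mu rep (phiW u)|.

(** [coM] is the completion of the coorbit space and [iota], of which only the
    values on [coorbit] matter, the canonical map. If [coorbit_norm] is only a
    seminorm, this is the Hausdorff completion. *)
Record coorbit_completion (coM : completeNormedModType R[i])
    (iota : antidual G -> coM) : Prop := {
  completion_linear : forall (a : R[i]) (u v : antidual G),
    coorbit u -> coorbit v -> iota (a *: u + v) = a *: iota u + iota v ;
  completion_isometric : forall u : antidual G,
    coorbit u -> `|iota u| = coorbit_norm u ;
  completion_dense : dense (iota @` coorbit)
}.

Record phiW_extension (coM : completeNormedModType R[i])
    (iota : antidual G -> coM) (Phi : {linear coM -> M}) : Prop := {
  extension_isometric : forall x : coM, `|Phi x| = `|x| ;
  extension_phiW : forall u : antidual G,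
    coorbit u -> Phi (iota u) = cls mu rep (phiW u)
}.

Definition continuously_embedded (coM : completeNormedModType R[i])
    (iota : antidual G -> coM) : Prop :=
  exists j : {linear coM -> antidual G},
    [/\ continuous j, injective j &
        forall u : antidual G, coorbit u -> j (iota u) = u].

End Coorbit.

(* Main.v *)
Require Import Defs.
From HB Require Import structures.
From mathcomp Require Import all_boot all_order all_algebra.
From mathcomp Require Import all_classical all_reals all_analysis.
From mathcomp Require Import measurable_realfun sesquilinear complex.
From mathcomp Require Import lra.

Set Implicit Arguments.
Unset Strict Implicit.
Unset Printing Implicit Defensive.

Import Order.TTheory GRing.Theory Num.Theory.
Import numFieldNormedType.Exports.

Local Open Scope classical_set_scope.
Local Open Scope ring_scope.

(** Write [phi x] for the function [s |-> <j x, w s>], where [j x] is the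
    functional in [G'] that corresponds to [x] in the completed coorbit space
    [coM].

    If the closure of [Omega] is compact, then [Phi Omega] is tight because the
    maps [f |-> \1_L f - f] do not increase norms (by solidity) and, along an
    increasing sequence of compact sets that covers [T], tend to [0] at each [f]
    (by absolute continuity of the norm); see [tight_of_compact].

    Conversely it suffices, by completeness of [coM] and because [Phi] is
    isometric, that every sequence in [Omega] has two entries whose transforms
    are close. Tightness allows one to compare the transforms on a single
    compact set [L]. There dominated convergence applies: by the uniform
    boundedness principle on [coM], the functions [phi x], for [x] in [Omega],
    are bounded on [L] by one constant ([phiW_bounded_on_compact],
    [phiW_dominated]). What is missing is a subsequence along which [phi x_n]
    converges at every point.

    The space [T] need not be separable, so a diagonal argument alone cannot
    give it. But [j Omega] is equicontinuous on [G] ([weakstar_equicontinuous]),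
    so that every limit of [j x_n] along an ultrafilter is again in [G']
    ([weakstar_ultra_limit]) and, by assumption on [w], the corresponding
    pointwise limit of [phi x_n] is a continuous function on [T]. A sequence of
    continuous functions on a sigma-compact space all of whose ultrafilter
    limits are continuous has a pointwise convergent subsequence
    ([pointwise_cvg_subsequence]).

    Finally, [Phi x] has to be recognized as the class of [phi x] for elements
    [x] of the completion too, and not only for those of the coorbit space
    ([rep_Phi]). *)

(** * The norm of a complex normed space as a real number *)

Section RealNorm.
Variables (R : realType).

(** Norms over [R[i]] are complex numbers that happen to be real; taking them in
    [R] gives access to its total order and to linear arithmetic. *)
Definition rnorm (V : normedModType R[i]) (x : V) : R := complex.Re `|x|.

Variable V : normedModType R[i].
Implicit Types x y : V.

Lemma rnormE x : `|x| = (rnorm x)%:C%C.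
Proof. by rewrite /rnorm RRe_real// ger0_real. Qed.

Lemma rnorm_ge0 x : 0 <= rnorm x.
Proof. by rewrite -ler0c -rnormE. Qed.

Lemma ler_rnormD x y : rnorm (x + y) <= rnorm x + rnorm y.
Proof. by rewrite -lecR rmorphD/= -!rnormE ler_normD. Qed.

Lemma rnormN x : rnorm (- x) = rnorm x.
Proof. by rewrite /rnorm normrN. Qed.

Lemma rdistC x y : rnorm (x - y) = rnorm (y - x).
Proof. by rewrite -rnormN opprB. Qed.

Lemma ler_rdistD y x z : rnorm (x - z) <= rnorm (x - y) + rnorm (y - z).
Proof. by rewrite -[x - z](subrKA y) ler_rnormD. Qed.

Lemma rnorm0 : rnorm (0 : V) = 0.
Proof. by rewrite /rnorm normr0. Qed.

Lemma rnorm_eq0 x : rnorm x = 0 -> x = 0.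
Proof. by move=> x0; apply/eqP; rewrite -normr_eq0 rnormE x0. Qed.

Lemma rnormZ (a : R[i]) x : rnorm (a *: x) = rnorm (a : R[i]^o) * rnorm x.
Proof. by apply: complexI; rewrite rmorphM/= -!rnormE normrZ. Qed.

Lemma rnorm_real (a : R) : rnorm (a%:C%C : R[i]^o) = `|a|.
Proof. by rewrite /rnorm normc_def/= expr0n/= addr0 sqrtr_sqr. Qed.

Lemma rnormZr (a : R) x : rnorm (a%:C%C *: x) = `|a| * rnorm x.
Proof. by rewrite rnormZ rnorm_real. Qed.

Lemma gt0_realP (e : R[i]) : 0 < e -> exists2 r : R, 0 < r & e = r%:C%C.
Proof.
move=> e0; exists (complex.Re e); last by rewrite RRe_real// gtr0_real.
by rewrite -ltcR RRe_real// gtr0_real.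
Qed.

Lemma rnorm_ballE x (e : R) : ball x e%:C%C = [set y | rnorm (x - y) < e].
Proof. by rewrite -ball_normE; apply/seteqP; split=> y /=; rewrite rnormE ltcR. Qed.

Lemma nbhs_rnormP x (A : set V) : nbhs x A <->
  exists2 e : R, 0 < e & [set y | rnorm (x - y) < e] `<=` A.
Proof.
split=> [/nbhs_ballP[_ /= /gt0_realP[e e0 ->]]|[e e0 eA]].
  by rewrite rnorm_ballE; exists e.
by apply/nbhs_ballP; exists e%:C%C; rewrite /= ?ltcR// rnorm_ballE.
Qed.

Lemma rnorm_cvgP (I : Type) (F : set_system I) (FF : Filter F) (f : I -> V) x :
  f i @[i --> F] --> x <->
  forall e : R, 0 < e -> \forall i \near F, rnorm (x - f i) < e.
Proof.
split=> [/cvgrPdist_lt fx e e0|fx].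
  have := fx e%:C%C; rewrite ltcR => /(_ e0).
  by apply: filterS => i; rewrite rnormE ltcR.
apply/cvgrPdist_lt => _ /gt0_realP[e e0 ->]; apply: filterS (fx _ e0) => i.
by rewrite rnormE ltcR.
Qed.

Lemma rnorm_cvgP0 (I : Type) (F : set_system I) (FF : Filter F) (f : I -> V) :
  f i @[i --> F] --> (0 : V) <->
  forall e : R, 0 < e -> \forall i \near F, rnorm (f i) < e.
Proof.
rewrite rnorm_cvgP; split=> f0 e /f0; apply: filterS => i;
by rewrite sub0r rnormN.
Qed.

Lemma rnorm_continuous : continuous (@rnorm V).
Proof.
move=> x; apply/cvgrPdist_lt => e e0; apply/nbhs_rnormP; exists e => // y /= xy.
rewrite ltr_norml; have := ler_rnormD (x - y) y; have := ler_rnormD (y - x) x.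
by rewrite !subrK (rdistC y); lra.
Qed.

End RealNorm.

Lemma near_rdist_lt (R : realType) (T : topologicalType) (V : normedModType R[i])
    (h : T -> V) (t : T) (e : R) : continuous h -> 0 < e ->
  \forall s \near t, rnorm (h t - h s) < e.
Proof. by move=> hc e0; exact: ((rnorm_cvgP _ _ _).1 (hc t) _ e0). Qed.

Lemma rnorm_cauchy_cvg (R : realType) (V : completeNormedModType R[i])
    (F : set_system V) : ProperFilter F ->
  (forall e : R, 0 < e -> exists x, F [set y | rnorm (x - y) < e]) ->
  exists l : V, F --> l.
Proof.
move=> FF Fe; apply/cvg_ex; apply: cauchy_cvg; apply: cauchy_exP.
by move=> _ /gt0_realP[e e0 ->]; have [x Fx] := Fe e e0; exists x; rewrite rnorm_ballE.
Qed.

Lemma eventually_invS_lt (R : realType) (e : R) : 0 < e ->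
  exists N, forall n, (N <= n)%N -> n.+1%:R^-1 < e.
Proof.
move=> e0; have /= := near_infty_natSinv_lt (PosNum e0) => -[N _ NP].
by exists N; move=> n /NP.
Qed.

(** * Uniform boundedness on complex Banach spaces *)

Section UniformBoundedness.
Variables (R : realType) (X : completeNormedModType R[i]).
Variables (I : Type) (p : I -> X -> R).
Hypothesis pD : forall i x y, p i (x + y) <= p i x + p i y.
Hypothesis pZ : forall i (a : R) x, p i (a%:C%C *: x) = `|a| * p i x.
Hypothesis p_continuous : forall i, continuous (p i).
Hypothesis p_bounded : forall x, exists C, forall i, p i x <= C.

Let p0 i : p i 0 = 0.
Proof. by have := pZ i 0 0; rewrite normr0 mul0r scaler0. Qed.

Let pN i x : p i (- x) = p i x.
Proof. by rewrite -scaleN1r -[-1 : R[i]](rmorphN1 (real_complex R)) pZ normrN1 mul1r. Qed.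

(** Every small vector is the difference of a point of the ball and its center,
    so a bound on one ball, wherever it is, gives one around [0]. *)
Let bounded_on_ball a r C : 0 < r ->
  (forall i y, rnorm (a - y) < r -> p i y <= C) ->
  exists C, forall i x, p i x <= C * rnorm x.
Proof.
move=> r0 pC; exists (2 * C * (2 / r)) => i x.
have [->|x0] := eqVneq x 0; first by rewrite p0 rnorm0 mulr0.
have nx : 0 < rnorm x.
  rewrite lt_neqAle rnorm_ge0 andbT; apply/eqP => /esym/rnorm_eq0 xx.
  by rewrite xx eqxx in x0.
pose t := r / 2 / rnorm x.
have t0 : 0 < t by rewrite !divr_gt0.
have pa : p i a <= C by apply: pC; rewrite subrr rnorm0.
have pt : p i (t%:C%C *: x + a) <= C.
  apply: pC; rewrite rdistC addrK rnormZr gtr0_norm// /t divfK ?gt_eqF//; lra.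
have := pD i (t%:C%C *: x + a) (- a); rewrite addrK pN pZ gtr0_norm// => h.
have {}h : t * p i x <= 2 * C by lra.
have -> : 2 * C * (2 / r) * rnorm x = 2 * C / t.
  by rewrite /t !invf_div (mulrC (rnorm x)) -mulrA.
by rewrite ler_pdivlMr// mulrC.
Qed.

(** Banach-Steinhaus theorem, by nested balls: a family that is unbounded on
    every ball allows one to shrink balls so that on the [n]th of them some
    seminorm exceeds [n], and the point common to all of them contradicts the
    pointwise bound. *)
Theorem uniform_boundedness : exists C, forall i x, p i x <= C * rnorm x.
Proof.
apply: contrapT => unb.
(* A ball is a pair (center, radius); [b'] is a legitimate successor of [b]. *)
pose good (n : nat) (b b' : X * R) := [/\ 0 < b'.2, b'.2 <= n.+1%:R^-1,
  (forall y, rnorm (b'.1 - y) <= b'.2 -> rnorm (b.1 - y) <= b.2) &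
  (forall y, rnorm (b'.1 - y) <= b'.2 -> exists i, n%:R < p i y)].
have step (nb : nat * (X * R)) : exists b', 0 < nb.2.2 -> good nb.1 nb.2 b'.
  case: nb => n [a r] /=.
  have [r0|] := boolP (0 < r); last by exists (a, r).
  have [i [y [ay piy]]] : exists i y, rnorm (a - y) < r / 2 /\ n%:R < p i y.
    apply: contrapT => h; apply: unb; apply: (@bounded_on_ball a (r / 2) n%:R).
      by rewrite divr_gt0.
    move=> i y ay; rewrite leNgt; apply/negP => py; apply: h.
    by exists i, y.
  have [s s0 sP] : exists2 s, 0 < s &
      forall z, rnorm (y - z) < s -> n%:R < p i z.
    have /nbhs_rnormP[s s0 sP] : nbhs y (p i @^-1` [set t | n%:R < t]).
      by apply: p_continuous; exact: lt_nbhsr.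
    by exists s.
  exists (y, Num.min (s / 2) (Num.min (r / 2) n.+1%:R^-1)) => _; split => //=.
  - by rewrite !lt_min !divr_gt0//= invr_gt0.
  - by rewrite !ge_min lexx !orbT.
  - move=> z; rewrite !le_min => /and3P[_ yz _].
    by rewrite (le_trans (ler_rdistD y _ _))//; lra.
  - move=> z; rewrite !le_min => /and3P[yz _ _]; exists i; apply: sP; lra.
have [next nextP] := choice step.
pose b := fix b n := if n is m.+1 then next (m, b m) else (0, 1).
have b_gt0 n : 0 < (b n).2.
  by elim: n => [|n IH] //=; have [] := nextP (n, b n) IH.
have bP n : good n (b n) (b n.+1) by exact: (nextP (n, b n) (b_gt0 n)).
have b_nested n m y : (n <= m)%N -> rnorm ((b m).1 - y) <= (b m).2 ->
    rnorm ((b n).1 - y) <= (b n).2.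
  elim: m => [|m IH]; first by rewrite leqn0 => /eqP ->.
  rewrite leq_eqVlt => /orP[/eqP->//|/IH {}IH] h.
  by apply: IH; have [_ _ + _] := bP m; apply.
have b_center n m : (n <= m)%N -> rnorm ((b n).1 - (b m).1) <= (b n).2.
  by move=> /b_nested; apply; rewrite subrr rnorm0 ltW.
have [l bl] : exists l : X, (b n).1 @[n --> \oo] --> l.
  apply: rnorm_cauchy_cvg => e e0; have [N NP] := eventually_invS_lt e0.
  exists (b N.+1).1; exists N.+1 => // m /= /b_center /le_lt_trans; apply.
  by have [_ h _ _] := bP N; rewrite (le_lt_trans h)// NP.
have l_in n : rnorm ((b n).1 - l) <= (b n).2.
  apply/ler_addgt0Pr => e e0; move/rnorm_cvgP : bl => /(_ _ e0)[N _ NP].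
  have := ler_rdistD (b (maxn n N)).1 (b n).1 l.
  have := b_center _ _ (leq_maxl n N).
  have := NP _ (leq_maxr n N); rewrite /= (rdistC l); lra.
have [C CP] := p_bounded l.
have [_ _ _ /(_ _ (l_in _))[i ni]] := bP (Num.bound `|C|).
have := lt_le_trans ni (CP i).
by rewrite ltNge (le_trans (ler_norm C))// ltW// archi_boundP.
Qed.

End UniformBoundedness.

(** * Continuous antilinear functionals and the weak-* topology *)

Section Antidual.
Variables (R : realType) (G : tvsType R[i]).

Lemma affine_continuous (t : R[i]) (a : G) : continuous (fun v => t *: (v - a)).
Proof.
move=> v; apply: (@continuous_comp _ _ _ (fun v => (t, v - a) : R[i]^o * G)
  (fun z => z.1 *: z.2)); last exact: scale_continuous.
apply: (@cvg_pair _ _ _ _ (nbhs (t : R[i]^o))); first exact: cvg_cst.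
apply: (@continuous_comp _ _ _ (fun v => (v, - a)) (fun z : G * G => z.1 + z.2)).
  by apply: cvg_pair => /=; [exact: cvg_id|exact: cvg_cst].
exact: add_continuous.
Qed.

Lemma nbhs_affine (t : R[i]) (a : G) (V : set G) :
  nbhs 0 V -> nbhs a [set v | V (t *: (v - a))].
Proof.
by move=> V0; apply: (@affine_continuous t a a); rewrite /= subrr scaler0.
Qed.

Implicit Types (u : antidual G) (v : G).

Lemma rnormM (a b : R[i]) :
  rnorm (a * b : R[i]^o) = rnorm (a : R[i]^o) * rnorm (b : R[i]^o).
Proof. exact: (@rnormZ R R[i]^o a b). Qed.

Lemma antidualP u a v v' : u (a *: v + v') = (a^*)%C * u v + u v'.
Proof. by have /set_mem[h _] := antidual_funP u; exact: h. Qed.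

Lemma antidual_continuous u : continuous u.
Proof. by have /set_mem[] := antidual_funP u. Qed.

Lemma antidual0 u : u 0 = 0.
Proof.
have := antidualP u 1 0 0; rewrite scale1r addr0 rmorph1 mul1r.
by move/eqP; rewrite -subr_eq subrr => /eqP.
Qed.

Lemma antidualZ u a v : u (a *: v) = (a^*)%C * u v.
Proof. by rewrite -[a *: v]addr0 antidualP antidual0 addr0. Qed.

Lemma antidual_linear_eval (X : lmodType R[i]) (j : {linear X -> antidual G}) a x y v :
  j (a *: x + y) v = a * j x v + j y v.
Proof. by rewrite linearP. Qed.

Lemma eval_continuous v : continuous (fun u => u v : R[i]^o).
Proof.
move=> u; apply: (@continuous_comp _ {ptws G -> R[i]^o} _
  (fun u : antidual G => antidual_fun u) (fun f => f v)).
  exact: initial_continuous.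
exact: (@proj_continuous _ (fun=> R[i]^o)).
Qed.

End Antidual.

Lemma metrizable_nbhs_basis (R : realType) (T : topologicalType) (x : T) :
  metrizable R T ->
  exists V : nat -> set T, (forall n, nbhs x (V n)) /\
    forall U, nbhs x U -> exists N, forall n, (N <= n)%N -> V n `<=` U.
Proof.
case=> d [_ _ _ dn]; exists (fun n => [set y | d x y < n.+1%:R^-1]); split.
  by move=> n; rewrite dn; exists n.+1%:R^-1 => //=; rewrite invr_gt0.
move=> U; rewrite dn => -[e /= e0 eU]; have [N NP] := eventually_invS_lt e0.
by exists N; move=> n /NP ne y /= /lt_trans /(_ ne) /eU.
Qed.

Section Equicontinuity.
Variables (R : realType) (X : completeNormedModType R[i]) (G : tvsType R[i]).
Variable j : {linear X -> antidual G}.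
Hypothesis j_continuous : continuous j.

Lemma weakstar_eval_continuous v : continuous (fun x => j x v : R[i]^o).
Proof.
by move=> x; apply: (@continuous_comp _ _ _ j (fun u : antidual G => u v));
  [exact: j_continuous|exact: eval_continuous].
Qed.

Lemma weakstar_uniform_bound (I : Type) (v : I -> G) :
  (forall x, exists C, forall i, rnorm (j x (v i)) <= C) ->
  exists C, forall i x, rnorm (j x (v i)) <= C * rnorm x.
Proof.
apply: (@uniform_boundedness R X I (fun i x => rnorm (j x (v i)))).
- by move=> i x y; rewrite -[x]scale1r antidual_linear_eval mul1r scale1r ler_rnormD.
- move=> i a x; rewrite -[_ *: x]addr0 antidual_linear_eval linear0 addr0.
  by rewrite rnormM rnorm_real.
- move=> i x; apply: (@continuous_comp _ _ _ (fun x => j x (v i) : R[i]^o)).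
    exact: weakstar_eval_continuous.
  exact: rnorm_continuous.
Qed.

(** The unit ball of [X] is mapped to an equicontinuous set. Otherwise there are
    vectors [v] in smaller and smaller neighborhoods of [0], on which the ball
    is not bounded by [1]. A metrizable space leaves room for a factor: the
    [v]s may be so small that [n.+1 *: v] still tends to [0]. These multiples
    define a pointwise bounded family of functionals on [X], and their uniform
    bound, divided by [n.+1], falls below [1]. *)
Lemma weakstar_equicontinuous : metrizable R G ->
  exists2 U : set G, nbhs 0 U & forall v x, U v -> rnorm (j x v) <= rnorm x.
Proof.
move=> /(metrizable_nbhs_basis 0)[V [V0 VP]]; apply: contrapT => neq.
have /choice[vx vxP] n : exists vx : G * X,
    V n (n.+1%:R%:C%C *: vx.1) /\ rnorm vx.2 < rnorm (j vx.2 vx.1).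
  apply: contrapT => nh; apply: neq.
  exists [set v | V n (n.+1%:R%:C%C *: v)].
    by have := nbhs_affine n.+1%:R%:C%C 0 (V0 n); apply: filterS => v /=; rewrite subr0.
  move=> v x Vv; rewrite leNgt; apply/negP => xv; apply: nh.
  by exists (v, x).
pose y n := n.+1%:R%:C%C *: (vx n).1.
have [C CP] : exists C, forall n x, rnorm (j x (y n)) <= C * rnorm x.
  apply: weakstar_uniform_bound => x.
  have jx0 : (j x v : R[i]^o) @[v --> (0 : G)] --> (0 : R[i]^o).
    by rewrite -[X in _ --> X](antidual0 (j x)); exact: antidual_continuous.
  have /VP[N NP] : \forall v \near (0 : G), rnorm (j x v : R[i]^o) < 1.
    exact: (rnorm_cvgP0 _ _).1 jx0 _ ltr01.
  (* The first [N] values are bounded by their sum, the others by [1]. *)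
  exists (1 + \sum_(i < N) rnorm (j x (y i))) => n.
  have [nN|Nn] := ltnP n N.
    rewrite (bigD1 (Ordinal nN))//= addrCA lerDl addr_ge0// sumr_ge0// => i _.
    exact: rnorm_ge0.
  apply: ler_wpDr; first by apply: sumr_ge0 => i _; exact: rnorm_ge0.
  by apply/ltW/(NP n Nn); have [] := vxP n.
pose n := Num.bound `|C|.
have Cn : C <= n%:R.
  by rewrite (le_trans (ler_norm C))// ltW// archi_boundP.
have [_ xn] := vxP n; have := CP n (vx n).2.
rewrite antidualZ conjc_real rnormM rnorm_real ger0_norm// => h.
have x0 := rnorm_ge0 (vx n).2.
have : C * rnorm (vx n).2 <= n%:R * rnorm (j (vx n).2 (vx n).1).
  by rewrite (le_trans (ler_wpM2r _ Cn))// ler_wpM2l// ltW.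
move/(le_trans h); rewrite -natr1 mulrDl mul1r; lra.
Qed.

End Equicontinuity.

(** * Limits along ultrafilters *)

Section UltrafilterLimits.
Variable R : realType.

Lemma fmap_ultra (I J : Type) (f : I -> J) (F : set_system I) :
  UltraFilter F -> UltraFilter (f @ F).
Proof.
move=> FU; split; first exact: fmap_proper_filter.
move=> H HP sFH; apply/seteqP; split=> // A HA.
have [//|FnA] := in_ultra_setVsetC (f @^-1` A) FU.
have HnA : H (~` A) by exact: sFH.
by case: (@filter_not_empty _ H HP); rewrite -(setICr A); exact: filterI.
Qed.

Lemma ultra_mem (I : Type) (F : set_system I) (A : set I) : Filter F ->
  (forall V, UltraFilter V -> F `<=` V -> V A) -> F A.
Proof.
move=> FF h; apply: contrapT => FA.
have wP : ProperFilter (within (~` A) F).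
  split; last exact: within_filter.
  move=> wA; apply: FA; apply: (@filterS _ F _ _ _ _ wA) => i /= nA.
  exact: contrapT.
have [V [VU wV]] := ultraFilterLemma wP.
have VA : V A.
  by apply: h => // B FB; apply: wV; apply: (@filterS _ F _ _ _ _ FB) => i + _.
have VnA : V (~` A) by apply: wV; exact: (@filterE _ F).
by apply: (@filter_not_empty _ V); rewrite -(setICr A); exact: filterI.
Qed.

Lemma bounded_ultra_cvgR (I : Type) (F : set_system I) (f : I -> R) (C : R) :
  UltraFilter F -> (forall i, `|f i| <= C) -> exists l : R, f i @[i --> F] --> l.
Proof.
move=> FU fC; have := @segment_compact R (- C) C; rewrite compact_ultra.
move=> /(_ _ (fmap_ultra f FU))[|l [_ fl]]; last by exists l.
by apply: (@filterE _ F) => i; rewrite /= in_itv/= -ler_norml fC.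
Qed.

Lemma ler_rnormReIm (z : R[i]^o) : rnorm z <= `|complex.Re z| + `|complex.Im z|.
Proof.
rewrite /rnorm normc_def /= -[leRHS]ger0_norm ?addr_ge0// -[leRHS]sqrtr_sqr.
rewrite ler_wsqrtr// sqrrD !real_normK ?num_real//.
by rewrite addrAC lerDl mulrn_wge0// mulr_ge0.
Qed.

Lemma ler_Re_rnorm (z : R[i]^o) : `|complex.Re z| <= rnorm z.
Proof. by rewrite -lecR -rnormE normc_ge_Re. Qed.

Lemma bounded_ultra_cvg (I : Type) (F : set_system I) (f : I -> R[i]^o) (C : R) :
  UltraFilter F -> (forall i, rnorm (f i) <= C) ->
  exists l : R[i]^o, f i @[i --> F] --> l.
Proof.
move=> FU fC.
have [|a fa] := @bounded_ultra_cvgR _ _ (fun i => complex.Re (f i)) C FU.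
  by move=> i; rewrite (le_trans (ler_Re_rnorm _)).
have [|b fb] := @bounded_ultra_cvgR _ _ (fun i => complex.Im (f i)) C FU.
  move=> i; rewrite (le_trans _ (fC i))// /rnorm normc_def/= -sqrtr_sqr.
  by rewrite ler_wsqrtr// lerDr sqr_ge0.
exists (a +i* b)%C; apply/rnorm_cvgP => e e0.
have e2 : 0 < e / 2 by rewrite divr_gt0.
move/cvgrPdist_lt : fa => /(_ _ e2); move/cvgrPdist_lt : fb => /(_ _ e2).
apply: filterS2 => i fb fa; apply: le_lt_trans (ler_rnormReIm _) _.
by move: fa fb; case: (f i) => x y /=; lra.
Qed.

Lemma complex_cvg_unique (I : Type) (F : set_system I) (f : I -> R[i]^o)
    (a b : R[i]^o) :
  ProperFilter F -> f i @[i --> F] --> a -> f i @[i --> F] --> b -> a = b.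
Proof. by move=> FF; apply: cvg_unique; exact: norm_hausdorff. Qed.

End UltrafilterLimits.

(** Boundedness gives a limit at each vector; equicontinuity is what makes the
    limit functional continuous, hence an element of the antidual. *)
Lemma weakstar_ultra_limit (R : realType) (X : completeNormedModType R[i])
    (G : tvsType R[i]) (j : {linear X -> antidual G}) (I : Type)
    (F : set_system I) (x : I -> X) (B : R) :
  metrizable R G -> continuous j -> UltraFilter F ->
  (forall i, rnorm (x i) <= B) ->
  exists u : antidual G, forall v, (j (x i) v : R[i]^o) @[i --> F] --> (u v : R[i]^o).
Proof.
move=> Gm jc FU xB.
have [U U0 UP] := weakstar_equicontinuous jc Gm.
have jb v : exists C, forall i, rnorm (j (x i) v) <= C.
  have [|C CP] := @weakstar_uniform_bound R X G j jc unit (fun=> v).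
    by move=> y; exists (rnorm (j y v)).
  exists (`|C| * B) => i; rewrite (le_trans (CP tt _))//.
  by rewrite (le_trans (ler_wpM2r (rnorm_ge0 _) (ler_norm C)))// ler_wpM2l.
have /choice[f fP] v : exists l : R[i]^o, (j (x i) v : R[i]^o) @[i --> F] --> l.
  by have [C] := jb v; exact: bounded_ultra_cvg.
have fL a v v' : f (a *: v + v') = (a^*)%C * f v + f v'.
  apply: (complex_cvg_unique (f := fun i => j (x i) (a *: v + v')) _ (fP _)).
  under eq_fun do rewrite antidualP.
  by apply: cvgD => //; apply: (@cvgZl_tmp R[i] R[i]^o).
have fU v : U v -> rnorm (f v) <= B.
  move=> Uv; apply/ler_addgt0Pr => e e0.
  have /rnorm_cvgP /(_ _ e0) := fP v; move/filter_ex => [i fi].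
  have := ler_rnormD (f v - j (x i) v) (j (x i) v); rewrite subrK.
  by have := UP v (x i) Uv; have := xB i; lra.
suff fC : continuous f.
  have fA : f \in @is_antidual R G by apply/mem_set; split.
  by exists (Antidual fA).
have [i _] := filter_ex (@filterT _ F _).
have B0 : 0 <= B by rewrite (le_trans (rnorm_ge0 (x i))).
(* [f] is at most [B] on [U], so it is below [e] on [t^-1 *: U]. *)
move=> v; apply/rnorm_cvgP => e e0.
pose t := (B + 1) / e.
have t0 : 0 < t by rewrite divr_gt0//; lra.
have := nbhs_affine t%:C%C v U0; apply: filterS => v' /= /fU.
have fZ a y : f (a *: y) = (a^*)%C * f y.
  have f0 : f 0 = 0.
    have := fL 1 0 0; rewrite scale1r addr0 rmorph1 mul1r.
    by move/eqP; rewrite -subr_eq subrr => /eqP.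
  by rewrite -[a *: y]addr0 fL f0 addr0.
have fB : f (v' - v) = f v' - f v.
  by rewrite addrC -scaleN1r fL rmorphN1 mulN1r addrC.
rewrite fZ conjc_real fB.
rewrite rnormM rnorm_real gtr0_norm// rdistC.
rewrite -ler_pdivlMl// /t invf_div => /le_lt_trans; apply.
have B1 : 0 < B + 1 by lra.
by rewrite mulrAC ltr_pdivrMr// ltr_pM2l// ltrDl.
Qed.

(** * Pointwise convergent subsequences of continuous functions *)

Section PointwiseSubsequence.
Variables (R : realType) (T : ptopologicalType) (f : nat -> T -> R[i]^o).
Hypothesis f_continuous : forall n, continuous (f n).

Lemma compact_finite_net (K : set T) (n : nat) (e : R) : compact K -> 0 < e ->
  exists D : seq T, {in D, forall t, K t} /\
    forall s, K s -> exists2 t, t \in D &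
      forall k, (k < n)%N -> rnorm (f k s - f k t) < e.
Proof.
rewrite compact_cover => Kc e0.
pose O t := [set s | forall k : 'I_n, rnorm (f k s - f k t) < e]°.
have OP t : O t t.
  have : \forall s \near t, forall k : 'I_n, rnorm (f k t - f k s) < e.
    by apply: filter_forall => k; exact: near_rdist_lt.
  by apply: filterS => s h k; rewrite rdistC.
have [||D DK KD] := Kc T K O.
- by move=> t _; exact: open_interior.
- by move=> t Kt; exists t.
exists (finmap.enum_fset D); split=> [t /DK|s /KD[t tD Ots]]; first by rewrite inE.
by exists t => // k kn; exact: (interior_subset Ots (Ordinal kn)).
Qed.

(** In a compact piece, choose finer and finer finite nets with respect to more
    and more of the [f k]. The points of the nets that approach [s] accumulate
    at some [t] which no [f k] distinguishes from [s], although [t] need not be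
    [s] and [s] need not lie in the closure. *)
Lemma countable_test_points : sigma_compact T ->
  exists e : nat -> T, forall s, exists2 t,
    closure (range e) t & forall k, f k t = f k s.
Proof.
move=> [L [Lc LT]].
have /choice[D DP] (mN : nat * nat) : exists D : seq T,
    {in D, forall t, L mN.1 t} /\
    forall s, L mN.1 s -> exists2 t, t \in D &
      forall k, (k < mN.2)%N -> rnorm (f k s - f k t) < mN.2.+1%:R^-1.
  by apply: compact_finite_net; rewrite ?invr_gt0.
(* [e] enumerates the points of all nets, indexed by piece, net and position. *)
pose e (i : nat) := if unpickle i is Some (m, N, k) then nth point (D (m, N)) k
                    else point.
have eD mN t : t \in D mN -> range e t.
  case: mN => m N tD; exists (pickle (m, N, index t (D (m, N)))) => //.
  by rewrite /e pickleK nth_index.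
exists e => s; have [m _ Lms] : (\bigcup_n L n) s by rewrite LT.
have /choice[t tP] N : exists t, t \in D (m, N) /\
    forall k, (k < N)%N -> rnorm (f k s - f k t) < N.+1%:R^-1.
  by have [_ /(_ _ Lms)[t tD tP]] := DP (m, N); exists t.
have [W [WU sW]] := ultraFilterLemma eventually_filter.
have := Lc m; rewrite compact_ultra => /(_ _ (fmap_ultra t WU)).
case=> [|t' [_ tt']].
  by apply: (@filterE _ W) => N; apply: (DP (m, N)).1; have [] := tP N.
exists t' => [B /tt' WB|k].
  have [N BtN] := @filter_ex _ W _ (t @^-1` B) WB; exists (t N); split => //.
  by have [/eD] := tP N.
apply: (@complex_cvg_unique _ _ W (fun N => f k (t N))).
  by apply: (@cvg_comp _ _ _ t (f k) W (nbhs t') _ tt'); exact: f_continuous.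
apply: (cvg_trans (cvg_app _ sW)); apply/rnorm_cvgP => r r0.
have [N NP] := eventually_invS_lt r0; exists (maxn N k.+1) => // n /=.
rewrite geq_max => /andP[/NP nr kn].
by have [_ /(_ _ kn)/lt_trans] := tP n; apply.
Qed.

(** The argument of Eberlein and Smulian. A subsequence converges at the
    countably many test points. Any two limits of it along ultrafilters are
    continuous functions which agree at the test points, hence on their
    closure, hence everywhere, because each point takes under all the [f n],
    and so under both limits, the same values as a point of that closure. *)
Lemma pointwise_cvg_subsequence : sigma_compact T ->
  (forall F : set_system nat, UltraFilter F -> exists2 g : T -> R[i]^o,
     continuous g & forall s, f n s @[n --> F] --> g s) ->
  exists phi : nat -> nat, (forall k, (k <= phi k)%N) /\
    exists2 g : T -> R[i]^o, continuous g &
      forall s, f (phi k) s @[k --> \oo] --> g s.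
Proof.
move=> Tsc ultra_lim; have [e eP] := countable_test_points Tsc.
have [F [FU sF]] := ultraFilterLemma eventually_filter.
have [g gc fg] := ultra_lim F FU.
have /choice[phi phiP] k : exists n, (k <= n)%N /\
    forall i : 'I_k, rnorm (g (e i) - f n (e i)) < k.+1%:R^-1.
  apply: (@filter_ex _ F); apply: filterI.
    by apply: sF; exists k.
  apply: filter_forall => i; have /rnorm_cvgP := fg (e i).
  by apply; rewrite invr_gt0.
exists phi; split; first by move=> k; have [] := phiP k.
(* It is enough to converge along each ultrafilter [V] that contains the tails. *)
exists g => // s; apply/rnorm_cvgP => r r0; apply: ultra_mem => V VU sV.
have [g' g'c fg'] := ultra_lim _ (fmap_ultra phi VU).
have gg'e i : g (e i) = g' (e i).
  apply: (complex_cvg_unique (F := V) (f := fun k => f (phi k) (e i))); last exact: fg'.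
  apply: (cvg_trans (cvg_app _ sV)); apply/rnorm_cvgP => q q0.
  have [N NP] := eventually_invS_lt q0; exists (maxn N i.+1) => // k /=.
  rewrite geq_max => /andP[/NP kq ik].
  by have [_ /(_ (Ordinal ik))/lt_trans] := phiP k; apply.
have [t et ft] := eP s.
have gg't : g t = g' t.
  apply/eqP; rewrite -subr_eq0; apply/eqP/rnorm_eq0/eqP.
  rewrite eq_le rnorm_ge0 andbT; apply/ler_addgt0Pr => q q0; rewrite add0r.
  have q2 : 0 < q / 2 by rewrite divr_gt0.
  have gq := near_rdist_lt t gc q2; have g'q := near_rdist_lt t g'c q2.
  have [_ [[i _ <-] [gi g'i]]] := et _ (filterI gq g'q).
  have := ler_rdistD (g (e i)) (g t) (g' t); rewrite !gg'e (rdistC (g' (e i))).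
  by move: gi g'i; rewrite /= gg'e; lra.
have gs : g s = g' s.
  have -> : g s = g t.
    by apply: (complex_cvg_unique _ (fg s)); under eq_fun do rewrite -ft; exact: fg.
  rewrite gg't.
  by apply: (complex_cvg_unique _ _ (fg' s)); under eq_fun do rewrite -ft; exact: fg'.
by have /rnorm_cvgP /(_ _ r0) := fg' s; rewrite -gs.
Qed.

End PointwiseSubsequence.

(** * Solid function spaces with absolutely continuous norm *)

Section FunctionSpaces.
Variables (R : realType) (T : ptopologicalType).
Variable mu : {measure set (borel T) -> \bar R}.

Lemma ae_eq_near (V : Type) (F F' : borel T -> V) :
  F = F' %[ae mu] <-> \forall s \ae mu, F s = F' s.
Proof. by split; apply: filterS => s // /(_ I). Qed.

Lemma open_borel (U : set T) : open U -> measurable (U : set (borel T)).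
Proof. exact: sub_gen_smallest. Qed.

Lemma compact_borel (L : set T) :
  hausdorff_space T -> compact L -> measurable (L : set (borel T)).
Proof.
move=> TH Lc; rewrite -[L]setCK; apply: measurableC; apply: open_borel.
by apply: closed_openC; exact: compact_closed.
Qed.

Lemma continuous_mu_measurable (F : T -> R[i]^o) : continuous F -> mu_measurable mu F.
Proof.
move=> /continuousP Fc U Uo; exists (F @^-1` U); first exact: open_borel (Fc _ Uo).
by exists set0; [exact: negligible_set0|rewrite setU0].
Qed.

(** A preimage under the product is the part in [L] of a preimage under [F],
    enlarged by the complement of [L] when the open set contains [0]. *)
Lemma mu_measurable_indic (L : set (borel T)) (F : borel T -> R[i]) :
  measurable L -> mu_measurable mu F -> mu_measurable mu (fun s => \1_L s * F s).
Proof.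
move=> Lm Fm U Uo; have [A Am [N Nn ANU]] := Fm U Uo.
pose B : set (borel T) := if 0 \in U then ~` L else set0.
have Bm : measurable B by rewrite /B; case: ifP => _ //; exact: measurableC.
exists ((A `&` L) `|` B); first by apply: measurableU => //; exact: measurableI.
exists (N `&` L); first by apply: negligibleS Nn; exact: subIsetl.
apply/seteqP; split=> s /=; rewrite indicE.
- have AN : (A `|` N) s -> U (F s) by rewrite ANU.
  case=> [[[As Ls]|]|[Ns Ls]].
  + by rewrite mem_set// mul1r; apply: AN; left.
  + rewrite /B; case: ifPn => [U0 Ls|//]; rewrite memNset// mul0r.
    exact: set_mem U0.
  + by rewrite mem_set// mul1r; apply: AN; right.
- have AN : U (F s) -> (A `|` N) s by rewrite ANU.
  have [Ls|Ls] := pselect (L s).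
    by rewrite mem_set// mul1r => /AN[As|Ns]; [left; left|right].
  by rewrite memNset// mul0r => U0; left; right; rewrite /B mem_set.
Qed.

Lemma ler_indic_norm (L : set T) (s : T) (z : R[i]) : `|\1_L s * z| <= `|z|.
Proof.
rewrite normrM indicE; case: (s \in L); first by rewrite normr1 mul1r.
by rewrite normr0 mul0r.
Qed.

Variables (M : completeNormedModType R[i]) (rep : M -> borel T -> R[i]).
Hypothesis M_space : function_space mu rep.
Hypothesis M_solid : solid_absolutely_continuous mu rep.

Lemma rep_cls (F : borel T -> R[i]) :
  in_space mu rep F -> rep (cls mu rep F) = F %[ae mu].
Proof. by move=> Fin; exact: (xgetPex 0 Fin). Qed.

Lemma cls_eq (f : M) (F : borel T -> R[i]) : rep f = F %[ae mu] -> cls mu rep F = f.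
Proof.
move=> fF; apply: (rep_injective M_space).
by apply: ae_eq_trans (ae_eq_sym fF); apply: rep_cls; exists f.
Qed.

Lemma cls_rep (f : M) : cls mu rep (rep f) = f.
Proof. by apply: cls_eq; exact: ae_eq_refl. Qed.

Lemma repB (f g : M) : rep (f - g) = (fun s => rep f s - rep g s) %[ae mu].
Proof.
rewrite -scaleN1r addrC; have /ae_eq_near h := rep_linear M_space (-1) g f.
by apply/ae_eq_near; apply: filterS h => s ->; rewrite mulN1r addrC.
Qed.

Lemma repZ (a : R[i]) (f : M) : rep (a *: f) = (fun s => a * rep f s) %[ae mu].
Proof.
have /ae_eq_near h0 := repB 0 0; rewrite subrr in h0.
rewrite -[a *: f]addr0; have /ae_eq_near h := rep_linear M_space a f 0.
by apply/ae_eq_near; apply: filterS2 h h0 => s -> ->; rewrite subrr addr0.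
Qed.

Lemma cls_ae (F F' : borel T -> R[i]) : in_space mu rep F -> F = F' %[ae mu] ->
  cls mu rep F = cls mu rep F'.
Proof.
by move=> /rep_cls Fin FF'; apply/esym/cls_eq; exact: ae_eq_trans Fin FF'.
Qed.

Lemma clsB (F F' : borel T -> R[i]) : in_space mu rep F -> in_space mu rep F' ->
  cls mu rep (fun s => F s - F' s) = cls mu rep F - cls mu rep F'.
Proof.
move=> /rep_cls/ae_eq_near Fin /rep_cls/ae_eq_near F'in; apply: cls_eq; apply/ae_eq_near.
have /ae_eq_near h := repB (cls mu rep F) (cls mu rep F').
by apply: filterS3 Fin F'in h => s <- <- ->.
Qed.

Lemma in_space_rep (f : M) : in_space mu rep (rep f).
Proof. by exists f; exact: ae_eq_refl. Qed.

Lemma in_space_indic (L : set (borel T)) (f : M) : measurable L ->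
  in_space mu rep (fun s => \1_L s * rep f s).
Proof.
move=> Lm; apply: (solid_le M_solid _ (rep_measurable M_space f) _ _).1.
- by apply: mu_measurable_indic => //; exact: (rep_measurable M_space).
- by apply: filterE => s; exact: ler_indic_norm.
- exact: in_space_rep.
Qed.

Lemma rep_mul_indic (L : set (borel T)) (f : M) : measurable L ->
  rep (mul_indic mu rep L f) = (fun s => \1_L s * rep f s) %[ae mu].
Proof. by move=> Lm; apply: rep_cls; exact: in_space_indic. Qed.

Lemma mul_indicB (L : set (borel T)) (f g : M) : measurable L ->
  mul_indic mu rep L (f - g) = mul_indic mu rep L f - mul_indic mu rep L g.
Proof.
move=> Lm; rewrite /mul_indic -clsB; [|exact: in_space_indic..].
apply: cls_ae; first exact: in_space_indic.
have /ae_eq_near h := repB f g; apply/ae_eq_near; apply: filterS h => s ->.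
by rewrite mulrBr.
Qed.

Lemma ler_norm_mul_indic (L : set (borel T)) (f : M) : measurable L ->
  `|mul_indic mu rep L f| <= `|f|.
Proof.
move=> Lm; rewrite -[f in leRHS]cls_rep.
apply: (solid_le M_solid _ (rep_measurable M_space f) _ _).2.
- by apply: mu_measurable_indic => //; exact: (rep_measurable M_space).
- by apply: filterE => s; exact: ler_indic_norm.
- exact: in_space_rep.
Qed.

Lemma ler_norm_mul_indicB (L : set (borel T)) (f : M) : measurable L ->
  `|mul_indic mu rep L f - f| <= `|f|.
Proof.
move=> Lm; have -> : mul_indic mu rep L f - f = -1 *: mul_indic mu rep (~` L) f.
  apply: (rep_injective M_space).
  have /ae_eq_near h1 := repB (mul_indic mu rep L f) f.
  have /ae_eq_near h2 := repZ (-1) (mul_indic mu rep (~` L) f).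
  have /ae_eq_near h3 := rep_mul_indic f Lm.
  have /ae_eq_near h4 := rep_mul_indic f (measurableC Lm).
  apply/ae_eq_near; apply: filterS2 (filterI h1 h2) (filterI h3 h4).
  move=> s [-> ->] [-> ->]; rewrite !indicE in_setC.
  by case: (s \in L) => /=; rewrite ?mul1r ?mul0r ?mulN1r ?subrr ?sub0r ?oppr0.
by rewrite scaleN1r normrN; apply: ler_norm_mul_indic; exact: measurableC.
Qed.

(** Each product is dominated by [f] itself, which makes compact exhaustions
    approximate any single element in norm. *)
Lemma mul_indic_cvg (L : nat -> set (borel T)) (f : M) :
  (forall n, measurable (L n)) -> {homo L : m n / (m <= n)%N >-> m `<=` n} ->
  (forall s, exists n, L n s) ->
  mul_indic mu rep (L n) f @[n --> \oo] --> f.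
Proof.
move=> Lm Lhomo LT; apply/rnorm_cvgP => e e0.
have fin := in_space_rep f.
have h1 n : mu_measurable mu (fun s => \1_(L n) s * rep f s).
  by apply: mu_measurable_indic => //; exact: (rep_measurable M_space).
have h2 n : \forall s \ae mu, `|\1_(L n) s * rep f s| <= `|rep f s|.
  by apply: filterE => s; exact: ler_indic_norm.
have h3 : \forall s \ae mu,
    (fun n => \1_(L n) s * rep f s : R[i]^o) @ \oo --> (rep f s : R[i]^o).
  apply: filterE => s; have [N LNs] := LT s.
  apply/rnorm_cvgP => r r0; exists N => // n /= Nn.
  by rewrite indicE mem_set ?mul1r ?subrr ?rnorm0//; exact: (Lhomo N n Nn s LNs).
have /rnorm_cvgP0 := solid_dominated M_solid fin fin h1 h2 h3.
move/(_ _ e0); apply: filterS => n.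
rewrite clsB; [|exact: in_space_indic|exact: in_space_rep].
by rewrite cls_rep rdistC /rnorm normr_id.
Qed.

Section LocalDomination.
Variable L : set (borel T).
Hypotheses (Lm : measurable L) (Lfin : (mu L < +oo)%E).

Lemma in_space_cst_indic (C : R) : in_space mu rep (fun s => C%:C%C * \1_L s).
Proof.
have [f /ae_eq_near fL] := solid_indic M_solid Lm Lfin; exists (C%:C%C *: f).
have /ae_eq_near h := repZ C%:C%C f; apply/ae_eq_near.
by apply: filterS2 h fL => s -> ->.
Qed.

Let ler_indic_cst (C : R) (F : borel T -> R[i]^o) s :
  (forall s, L s -> rnorm (F s) <= C) -> `|\1_L s * F s| <= `|C%:C%C * \1_L s|.
Proof.
move=> FC; rewrite indicE; have [Ls|Ls] := pselect (L s).
  rewrite mem_set// mul1r mulr1 (@rnormE R R[i]^o) (@rnormE R R[i]^o).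
  by rewrite lecR rnorm_real (le_trans (FC s Ls))// ler_norm.
by rewrite memNset// mul0r normr0.
Qed.

Let mu_measurable_cst_indic (C : R) : mu_measurable mu (fun s => C%:C%C * \1_L s).
Proof.
have h := mu_measurable_indic Lm
  (continuous_mu_measurable (@cst_continuous _ R[i]^o C%:C%C)).
by move=> U Uo; have := h U Uo; congr completed_algebra_gen; apply/seteqP; split=> s;
  rewrite /= mulrC.
Qed.

Lemma in_space_bounded (C : R) (F : borel T -> R[i]^o) : mu_measurable mu F ->
  (forall s, L s -> rnorm (F s) <= C) -> in_space mu rep (fun s => \1_L s * F s).
Proof.
move=> Fm FC; apply: (solid_le M_solid _ (mu_measurable_cst_indic C) _ _).1.
- exact: mu_measurable_indic.
- by apply: filterE => s; exact: ler_indic_cst.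
- exact: in_space_cst_indic.
Qed.

(** On a set of finite measure constants belong to the space, so a uniform bound
    is a domination. *)
Lemma bounded_dominated (C : R) (Fn : nat -> borel T -> R[i]^o) (F : borel T -> R[i]^o) :
  (forall n, mu_measurable mu (Fn n)) -> mu_measurable mu F ->
  (forall n s, L s -> rnorm (Fn n s) <= C) ->
  (forall s, L s -> Fn n s @[n --> \oo] --> F s) ->
  cls mu rep (fun s => \1_L s * Fn n s) @[n --> \oo]
    --> cls mu rep (fun s => \1_L s * F s).
Proof.
move=> Fnm Fm FnC FnF.
have FC s : L s -> rnorm (F s) <= C.
  move=> Ls; apply/ler_addgt0Pr => e e0.
  have /rnorm_cvgP/(_ _ e0)/filter_ex[n nF] := FnF s Ls.
  by have := ler_rnormD (F s - Fn n s) (Fn n s); rewrite subrK; have := FnC n s Ls; lra.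
have Fin := in_space_bounded Fm FC.
have Fnin n := in_space_bounded (Fnm n) (FnC n).
have h2 n : \forall s \ae mu, `|\1_L s * Fn n s| <= `|C%:C%C * \1_L s|.
  by apply: filterE => s; apply: ler_indic_cst; exact: FnC.
have h3 : \forall s \ae mu,
    (fun n => \1_L s * Fn n s : R[i]^o) @ \oo --> (\1_L s * F s : R[i]^o).
  apply: filterE => s; rewrite indicE; have [Ls|Ls] := pselect (L s).
    by rewrite mem_set// mul1r; under eq_fun do rewrite mul1r; exact: FnF.
  by rewrite memNset// mul0r; under eq_fun do rewrite mul0r; exact: cvg_cst.
have := solid_dominated M_solid Fin (in_space_cst_indic C)
  (fun n => mu_measurable_indic Lm (Fnm n)) h2 h3.
move=> /rnorm_cvgP0 h; apply/rnorm_cvgP => e /h; apply: filterS => n.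
by rewrite clsB// rdistC /rnorm normr_id.
Qed.

End LocalDomination.

End FunctionSpaces.

(** * Compactness criteria *)

Section Compactness.
Variable R : realType.

Lemma ultra_has_mem (I : Type) (J : eqType) (F : set_system I) (l : seq J)
    (P : J -> set I) : UltraFilter F ->
  F [set i | exists2 y, y \in l & P y i] -> exists2 y, y \in l & F (P y).
Proof.
move=> FU; elim: l => [|y l IH] Fl.
  by have [i [y]] := filter_ex Fl.
have [Py|Pny] := in_ultra_setVsetC (P y) FU; first by exists y; rewrite ?mem_head.
have [|z zl Pz] := IH; last by exists z; rewrite ?in_cons ?zl ?orbT.
apply: filterS2 Fl Pny => i [z]; rewrite in_cons => /orP[/eqP ->//|zl Pzi] _.
by exists z.
Qed.

(** If finitely many balls of some radius never covered [A], one could pick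
    points of [A] one after the other, each far from all the previous ones. So
    [A] is totally bounded, and ultrafilters on its closure are Cauchy. *)
Lemma compact_closure_of_close_pairs (X : completeNormedModType R[i]) (A : set X) :
  (forall (e : R) (x : nat -> X), 0 < e -> (forall n, A (x n)) ->
    exists n m, (n < m)%N /\ rnorm (x n - x m) < e) ->
  compact (closure A).
Proof.
move=> close_pair.
(* The list of the points picked so far is the state of the recursion. *)
have net (e : R) : 0 < e -> exists l : seq X, forall x, A x ->
    exists2 y, y \in l & rnorm (y - x) < e.
  move=> e0; apply: contrapT => nonet.
  have /choice[next nextP] (l : seq X) : exists x, A x /\
      forall y, y \in l -> e <= rnorm (y - x).
    apply: contrapT => nx; apply: nonet; exists l => x Ax.
    apply: contrapT => ny; apply: nx; exists x; split => // y yl.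
    by rewrite leNgt; apply/negP => yx; apply: ny; exists y.
  pose hist n := iter n (fun l => next l :: l) [::].
  have hist_mem n m : (n < m)%N -> next (hist n) \in hist m.
    elim: m => // m IH; rewrite ltnS leq_eqVlt => /orP[/eqP ->|/IH h].
      by rewrite /= mem_head.
    by rewrite /= in_cons h orbT.
  have [n [m [nm]]] := close_pair e (fun n => next (hist n)) e0
    (fun n => (nextP _).1).
  by rewrite ltNge (nextP (hist m)).2// hist_mem.
rewrite compact_ultra => F FU FA.
have [|l Fl] := @rnorm_cauchy_cvg R X F _.
  move=> e e0; have e2 : 0 < e / 2 by rewrite divr_gt0.
  have [l lP] := net _ e2.
  have [|y _ Fy] := @ultra_has_mem _ _ F l
      (fun y => [set x | rnorm (y - x) < e]) FU; last by exists y.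
  apply: filterS FA => x Ax.
  have /Ax[z [/lP[y yl yz] /= xz]] : nbhs x [set z | rnorm (x - z) < e / 2].
    by apply/nbhs_rnormP; exists (e / 2).
  by exists y => //=; have := ler_rdistD z y x; rewrite (rdistC z); lra.
exists l; split=> //; apply: closed_closure => B /Fl FB.
exact: (filter_ex (filterI FA FB)).
Qed.

Lemma continuous_bounded_on_compact (T : topologicalType) (V : normedModType R[i])
    (h : T -> V) (L : set T) : continuous h -> compact L ->
  exists C : R, forall s, L s -> rnorm (h s) <= C.
Proof.
move=> hc Lc.
have rc : continuous (fun s => rnorm (h s)).
  by move=> s; apply: continuous_comp; [exact: hc|exact: rnorm_continuous].
have := continuous_compact (continuous_subspaceT rc) Lc.
move=> /(@compact_bounded R R^o)[C [_ CP]]; exists (C + 1) => s Ls.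
have := CP (C + 1); rewrite ltrDl ltr01 => /(_ isT (rnorm (h s))).
by rewrite /= ger0_norm ?rnorm_ge0//; apply; exists s.
Qed.

Lemma rnorm_bounded_set (V : normedModType R[i]) (A : set V) : bounded_set A ->
  exists B : R, forall x, A x -> rnorm x <= B.
Proof.
case=> _ [/complex_realP[m ->] mP]; exists (m + 1) => x Ax.
by rewrite -lecR -rnormE; apply: mP => //; rewrite ltcR ltrDl.
Qed.

Lemma increasing_compact_cover (T : topologicalType) : sigma_compact T ->
  exists L : nat -> set T, [/\ forall n, compact (L n),
    {homo L : m n / (m <= n)%N >-> m `<=` n} & forall s, exists n, L n s].
Proof.
move=> [L [Lc LT]].
pose K := fix K n := if n is m.+1 then K m `|` L m else set0.
have KS n : K n `<=` K n.+1 by move=> s; left.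
exists K; split.
- by elim=> [|n IH]; [exact: compact0|exact: compactU].
- by apply: homo_leq => [A|A B C|//]; [exact: subset_refl|exact: subset_trans].
- move=> s; have [n _ Lns] : (\bigcup_n L n) s by rewrite LT.
  by exists n.+1; right.
Qed.

End Compactness.

(** * The coorbit space *)

Section Coorbit.
Variables (R : realType) (T : ptopologicalType).
Hypotheses (T_hausdorff : hausdorff_space T) (T_sigma_compact : sigma_compact T).
Variable mu : {measure set (borel T) -> \bar R}.
Hypothesis mu_compact : forall L : set T, compact L -> (mu L < +oo)%E.
Variables (G : tvsType R[i]) (w : T -> G).
Hypothesis G_metrizable : metrizable R G.
Hypothesis w_continuous : forall u : antidual G, continuous (phiW w u).
Variables (M : completeNormedModType R[i]) (rep : M -> borel T -> R[i]).
Hypotheses (M_space : function_space mu rep)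
  (M_solid : solid_absolutely_continuous mu rep).
Variables (coM : completeNormedModType R[i]) (iota : antidual G -> coM).
Hypothesis coM_completion : coorbit_completion mu w rep iota.
Variable Phi : {linear coM -> M}.
Hypothesis Phi_extension : phiW_extension mu w rep iota Phi.
Variable j : {linear coM -> antidual G}.
Hypotheses (j_continuous : continuous j)
  (j_iota : forall u, coorbit mu w rep u -> j (iota u) = u).

Let compact_measurable L : compact L -> measurable (L : set (borel T)).
Proof. exact: compact_borel. Qed.

Let phiW_measurable u : mu_measurable mu (phiW w u).
Proof. exact/continuous_mu_measurable/w_continuous. Qed.

Lemma Phi_rnorm x : rnorm (Phi x) = rnorm x.
Proof. by rewrite /rnorm (extension_isometric Phi_extension). Qed.

Lemma ler_rnorm_indic L (f : M) : compact L -> rnorm (mul_indic mu rep L f) <= rnorm f.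
Proof.
move=> Lc; rewrite -lecR -!rnormE; apply: ler_norm_mul_indic => //.
exact: compact_measurable.
Qed.

(** For a fixed [x] the transform is continuous, so bounded on [L]; the uniform
    boundedness principle on [coM] makes the bound proportional to the norm. *)
Lemma phiW_bounded_on_compact L : compact L ->
  exists C, forall s x, L s -> rnorm (j x (w s)) <= C * rnorm x.
Proof.
move=> Lc; have [x|C CP] := @weakstar_uniform_bound R coM G j j_continuous
    {s | L s} (fun s => w (projT1 s)).
  have [C CP] := continuous_bounded_on_compact (@w_continuous (j x)) Lc.
  by exists C => -[s Ls]; exact: CP.
by exists C => s x Ls; exact: (CP (exist _ s Ls)).
Qed.

(** Transforms of a bounded sequence are bounded on [L] by one constant, so that
    absolute continuity of the norm applies to their restrictions. *)
Lemma phiW_dominated L (x : nat -> coM) (B : R) (g : T -> R[i]^o) :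
  compact L -> continuous g -> (forall n, rnorm (x n) <= B) ->
  (forall s, phiW w (j (x n)) s @[n --> \oo] --> g s) ->
  cls mu rep (fun s => \1_L s * phiW w (j (x n)) s) @[n --> \oo]
    --> cls mu rep (fun s => \1_L s * g s).
Proof.
move=> Lc gc xB xg; have [C CP] := phiW_bounded_on_compact Lc.
apply: (@bounded_dominated _ _ mu M rep M_space M_solid L (compact_measurable Lc)
  (mu_compact Lc) (`|C| * B)) => //.
- exact: continuous_mu_measurable.
- move=> n s Ls; rewrite (le_trans (CP s (x n) Ls))//.
  by rewrite (le_trans (ler_wpM2r (rnorm_ge0 _) (ler_norm C)))// ler_wpM2l.
Qed.

Lemma coorbit_approximation x : exists u : nat -> antidual G,
  [/\ forall n, coorbit mu w rep (u n), iota (u n) @[n --> \oo] --> x &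
      forall n, rnorm (iota (u n)) <= rnorm x + 1].
Proof.
have /choice[u uP] n : exists u, coorbit mu w rep u /\ rnorm (x - iota u) < n.+1%:R^-1.
  have n0 : 0 < n.+1%:R^-1 :> R by rewrite invr_gt0.
  have [||p [xp [u cu up]]] := completion_dense coM_completion
      (O := ball x (n.+1%:R^-1)%:C%C).
  - by exists x; rewrite rnorm_ballE/= subrr rnorm0.
  - exact: ball_open.
  by exists u; split => //; move: xp; rewrite -up rnorm_ballE.
exists u; split => [n||n]; first by have [] := uP n.
  apply/rnorm_cvgP => e e0; have [N NP] := eventually_invS_lt e0.
  by exists N => // n /= /NP; apply: lt_trans; have [] := uP n.
have := ler_rnormD (iota (u n) - x) x; rewrite subrK rdistC => h.
rewrite (le_trans h)// addrC lerD2l (le_trans (ltW (uP n).2))//.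
by rewrite invf_le1 ?ler1n.
Qed.

Lemma rep_Phi_coorbit u : coorbit mu w rep u -> rep (Phi (iota u)) = phiW w u %[ae mu].
Proof.
by move=> cu; rewrite (extension_phiW Phi_extension cu); exact: rep_cls.
Qed.

Lemma cls_indic_phiW L x : compact L -> rep (Phi x) = phiW w (j x) %[ae mu] ->
  cls mu rep (fun s => \1_L s * phiW w (j x) s) = mul_indic mu rep L (Phi x).
Proof.
move=> Lc /ae_eq_near h; apply/esym/cls_ae => //.
  exact: (in_space_indic M_space M_solid _ (compact_measurable Lc)).
by apply/ae_eq_near; apply: filterS h => s ->.
Qed.

(** The abstract extension of the transform is computed by the functional [j x].
    This is so on the coorbit space; an approximating sequence from there
    converges weakly-*, so its transforms converge pointwise and, on each
    compact set, also in norm. Countably many compact sets cover [T]. *)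
Lemma rep_Phi x : rep (Phi x) = phiW w (j x) %[ae mu].
Proof.
have [u [cu ux uB]] := coorbit_approximation x.
have [L [Lc _ LT]] := increasing_compact_cover T_sigma_compact.
suff h n : \forall s \ae mu, \1_(L n) s * rep (Phi x) s = \1_(L n) s * phiW w (j x) s.
  apply/ae_eq_near; apply: filterS (ae_foralln h) => s hs.
  by have [n Ls] := LT s; have := hs n; rewrite indicE mem_set// !mul1r.
have Lm := compact_measurable (Lc n).
have lim1 : mul_indic mu rep (L n) (Phi (iota (u k))) @[k --> \oo]
    --> cls mu rep (fun s => \1_(L n) s * phiW w (j x) s).
  rewrite (_ : (fun k => _) =
    fun k => cls mu rep (fun s => \1_(L n) s * phiW w (j (iota (u k))) s)).
    apply: phiW_dominated uB _ => // s.
    apply: (@cvg_comp _ _ _ (fun k => iota (u k)) (fun y => j y (w s) : R[i]^o)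
      _ (nbhs x)) => //.
    exact: weakstar_eval_continuous.
  apply/funext => k; rewrite cls_indic_phiW// j_iota//; exact: rep_Phi_coorbit.
have lim2 : mul_indic mu rep (L n) (Phi (iota (u k))) @[k --> \oo]
    --> mul_indic mu rep (L n) (Phi x).
  apply/rnorm_cvgP => e e0; have /rnorm_cvgP/(_ _ e0) := ux; apply: filterS => k.
  rewrite -mul_indicB// -(linearB Phi); apply: le_lt_trans.
  by rewrite -(Phi_rnorm (x - _)) ler_rnorm_indic.
have e := cvg_unique (@norm_hausdorff _ M) lim1 lim2.
have /ae_eq_near h1 := rep_mul_indic M_space M_solid (Phi x) Lm.
have [C CP] := continuous_bounded_on_compact (@w_continuous (j x)) (Lc n).
have /rep_cls/ae_eq_near h2 := in_space_bounded M_space M_solid Lm (mu_compact (Lc n))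
  (phiW_measurable (j x)) CP.
by apply: filterS2 h1 h2 => s; rewrite e => <- <-.
Qed.

(** Compact exhaustions approximate each element, and do so uniformly near it
    since the maps [f |-> mul_indic L f - f] do not increase norms. *)
Lemma tight_of_compact (Omega : set coM) :
  compact (closure Omega) -> compact_tight mu rep (Phi @` Omega).
Proof.
rewrite compact_ultra => Oc e e0; apply: contrapT => ntight.
have [L [Lc Lhomo LT]] := increasing_compact_cover T_sigma_compact.
have Lm n := compact_measurable (Lc n).
have /choice[x xP] n : exists x, Omega x /\
    e < rnorm (mul_indic mu rep (L n) (Phi x) - Phi x).
  apply: contrapT => nx; apply: ntight; exists (L n) => // _ [x Ox <-].
  rewrite rnormE lecR leNgt; apply/negP => ex; apply: nx.
  by exists x.
have [W [WU sW]] := ultraFilterLemma eventually_filter.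
have [|p [_ xp]] := Oc _ (fmap_ultra x WU).
  by apply: (@filterE _ W) => n; apply: subset_closure; have [] := xP n.
have e2 : 0 < e / 2 by rewrite divr_gt0.
have := mul_indic_cvg M_space M_solid (f := Phi p) Lm Lhomo LT.
move=> /rnorm_cvgP/(_ _ e2)/sW near_p; move/rnorm_cvgP : xp => /(_ _ e2) near_xp.
have [n [pn xn]] := filter_ex (filterI near_p near_xp).
have := (xP n).2; apply/negP; rewrite -leNgt.
have -> : mul_indic mu rep (L n) (Phi (x n)) - Phi (x n) =
    (mul_indic mu rep (L n) (Phi p) - Phi p) -
    (mul_indic mu rep (L n) (Phi (p - x n)) - Phi (p - x n)).
  by rewrite (linearB Phi) mul_indicB//= opprB addrA subrKA opprB addrC subrKA.
rewrite (le_trans (ler_rnormD _ _))// rnormN rdistC.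
have : rnorm (mul_indic mu rep (L n) (Phi (p - x n)) - Phi (p - x n)) <= rnorm (p - x n).
  by rewrite -(Phi_rnorm (p - x n)) -lecR -!rnormE ler_norm_mul_indicB.
lra.
Qed.

(** Tightness reduces norm distances to distances of restrictions to one compact
    set, up to [e / 4] at each end; these restrictions converge along a
    subsequence. *)
Lemma compact_of_tight (Omega : set coM) : bounded_set Omega ->
  compact_tight mu rep (Phi @` Omega) -> compact (closure Omega).
Proof.
move=> /rnorm_bounded_set[B OB] tight; apply: compact_closure_of_close_pairs.
move=> e x e0 Ox.
have [F FU|phi [kphi [g gc xg]]] := pointwise_cvg_subsequence
    (fun n => @w_continuous (j (x n))) T_sigma_compact.
  have [u uP] := weakstar_ultra_limit G_metrizable j_continuous FU (fun n => OB _ (Ox n)).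
  by exists (phiW w u) => // s; exact: uP.
have e4 : 0 < e / 4 by rewrite divr_gt0.
have [L Lc Ltight] := tight _ e4.
have tail k : rnorm (mul_indic mu rep L (Phi (x k)) - Phi (x k)) <= e / 4.
  by rewrite -lecR -rnormE; apply: Ltight; exists (x k).
have : mul_indic mu rep L (Phi (x (phi k))) @[k --> \oo]
    --> cls mu rep (fun s => \1_L s * g s).
  have := phiW_dominated Lc gc (fun k => OB _ (Ox (phi k))) xg.
  by under eq_fun do rewrite (cls_indic_phiW Lc (rep_Phi _)).
move=> /rnorm_cvgP/(_ _ e4)[K _ KP].
(* [phi k >= k], so the index [phi k] exceeds [n] as soon as [k] does. *)
pose n := phi K; pose k := maxn K n.+1; exists n, (phi k); split.
  by rewrite (leq_trans _ (kphi k))// leq_maxr.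
have nK := KP K (leqnn K); have kK := KP k (leq_maxl _ _).
rewrite -Phi_rnorm (linearB Phi).
set z := cls _ _ _ in nK kK.
have := ler_rdistD (mul_indic mu rep L (Phi (x n))) (Phi (x n)) (Phi (x (phi k))).
have := ler_rdistD z (mul_indic mu rep L (Phi (x n))) (Phi (x (phi k))).
have := ler_rdistD (mul_indic mu rep L (Phi (x (phi k)))) z (Phi (x (phi k))).
have := tail n; have := tail (phi k); move: nK kK => /=.
rewrite -/n (rdistC (Phi (x n)) (mul_indic _ _ _ _)) (rdistC (mul_indic _ _ _ _) z).
lra.
Qed.

End Coorbit.

(** * The compactness criterion *)

Theorem theorem3p2
  (R : realType)
  (T : ptopologicalType)
  (T_hausdorff : hausdorff_space T)
  (T_locally_compact : locally_compact [set: T])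
  (T_sigma_compact : sigma_compact T)
  (mu : {measure set (borel T) -> \bar R})
  (mu_radon : radon_measure mu)
  (H : completeNormedModType R[i])
  (dot : {dot H for @Num.conj R[i]})
  (dot_norm : inner_product_norm dot)
  (H_separable : separable H)
  (G : tvsType R[i])
  (G_frechet : frechet_space G)
  (emb : {linear G -> H})
  (emb_injective : injective emb)
  (emb_continuous : continuous emb)
  (emb_dense : dense (range emb))
  (w : T -> G)
  (w_frame : tight_frame mu dot (emb \o w))
  (w_total : total_set (range w))
  (w_continuous : forall u : antidual G, continuous (phiW w u))
  (M : completeNormedModType R[i])
  (rep : M -> borel T -> R[i])
  (M_space : function_space mu rep)
  (M_solid : solid_absolutely_continuous mu rep)
  (coM : completeNormedModType R[i])
  (iota : antidual G -> coM)
  (coM_completion : coorbit_completion mu w rep iota)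
  (Phi : {linear coM -> M})
  (Phi_extension : phiW_extension mu w rep iota Phi)
  (coM_embedded : continuously_embedded mu w rep iota)
  (Omega : set coM)
  (Omega_bounded : bounded_set Omega) :
  compact (closure Omega) <-> compact_tight mu rep (Phi @` Omega).
Proof.
have [j [j_continuous _ j_iota]] := coM_embedded.
have G_metrizable := frechet_metrizable G_frechet.
have mu_compact := radon_compact mu_radon.
split.
  exact: (tight_of_compact T_hausdorff T_sigma_compact M_space M_solid Phi_extension).
exact: (compact_of_tight T_hausdorff T_sigma_compact mu_compact G_metrizable
  w_continuous M_space M_solid coM_completion Phi_extension j_continuous j_iota
  Omega_bounded).
Qed.
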